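(* Let $G$ be a simple graph with vertex set $V(G)=\{v_1,\dots,v_n\}$ and edge set $E(G)=\{e_1,\dots,e_m\}$, and let $1\le k\le n$. Let $\Phi^A_k(G,x)=d_{(k,1^{n-k})}(xI_n-A(G))$ and let $\Phi'^A_k(G,x)$ be its derivative with respect to $x$. For an edge $v_sv_t$ put $\Phi^{A(\square\square)}_k(G-v_s-v_t,x)=d_{(k-2,1^{n-k})}(xI_{n-2}-A(G-v_s-v_t))$ and $\Phi^{A(\mathrm{vert})}_k(G-v_s-v_t,x)=d_{(k,1^{n-k-2})}(xI_{n-2}-A(G-v_s-v_t))$. Then $$(m-n)\Phi^A_k(G,x)+x\,\Phi'^A_k(G,x)=\sum_{v_sv_t\in E(G)}\Big[\Phi^A_k(G-v_sv_t,x)-\Phi^{A(\square\square)}_k(G-v_s-v_t,x)+\Phi^{A(\mathrm{vert})}_k(G-v_s-v_t,x)\Big].$$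
   Context: For a partition $\lambda$ of $N$ with irreducible character $\chi_\lambda$ of $S_N$, the immanant of an $N\times N$ matrix $B=(b_{ij})$ is $d_\lambda(B)=\sum_{\sigma\in S_N}\chi_\lambda(\sigma)\prod_{i=1}^N b_{i\sigma(i)}$; hook immanants are those with $\lambda=(k,1^{N-k})$. An immanant $d_\lambda$ indexed by a sequence $\lambda$ that is not a partition (e.g. $(k-2,1^{n-k})$ with $k\le 2$, or $(k,1^{n-k-2})$ with $k\ge n-1$) is taken to be $0$. $A(G)$ is the adjacency matrix of $G$. $G-v_sv_t$ is obtained from $G$ by deleting the edge $v_sv_t$ and keeping all vertices; $G-v_s-v_t$ is obtained by deleting the vertices $v_s,v_t$ and all edges incident with them. The polynomial $\Phi^{A(\square\square)}_k$ corresponds to removing a horizontal domino rim hook from the Young diagram of $(k,1^{n-k})$, and $\Phi^{A(\mathrm{vert})}_k$ (written with a vertical domino in the paper) to removing a vertical domino rim hook.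
   Formalization: For n=2 the immanants indexed by (k-2,1^{n-k}) at k=2 and by (k,1^{n-k-2}) at k=1 are read as that of the empty partition (value 1) rather than 0; with 0 the identity fails for the graph with one edge on two vertices. *)

(* Defs.v *)
From HB Require Import structures.
From mathcomp Require Import all_boot all_order all_algebra.
From mathcomp Require Import all_fingroup all_solvable all_field all_character.

Set Implicit Arguments.
Unset Strict Implicit.
Unset Printing Implicit Defensive.

Import GRing.Theory.
Local Open Scope ring_scope.

(* A partition of N is a weakly decreasing sequence of naturals with sum N;    *)
(* trailing zeros are allowed, so [::] and [:: 0] both denote the empty one.   *)
Definition is_partition (N : nat) (la : seq nat) : bool :=
  sorted geq la && (sumn la == N).

Section FiberStabilizer.
Variables (N : nat) (f : 'I_N -> nat).

Definition fiber_stab : {set 'S_N} := [set s : 'S_N | [forall i, f (s i) == f i]].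

Fact fiber_stab_group_set : group_set fiber_stab.
Proof.
apply/group_setP; split=> [|s t].
  by rewrite inE; apply/forallP=> i; rewrite perm1.
rewrite !inE => /forallP sP /forallP tP; apply/forallP=> i.
by rewrite permM (eqP (tP _)) (eqP (sP _)).
Qed.

Canonical fiber_stab_group := Group fiber_stab_group_set.
End FiberStabilizer.

(* Row and column stabilizers of the Young tableau of shape la whose boxes are *)
(* filled with 0, 1, .., N-1 row by row.                                       *)
Definition row_stab (N : nat) (la : seq nat) : {group 'S_N} :=
  fiber_stab_group (fun i : 'I_N => reshape_index la i).
Definition col_stab (N : nat) (la : seq nat) : {group 'S_N} :=
  fiber_stab_group (fun i : 'I_N => reshape_offset la i).

Fact sign_is_class_fun (N : nat) :
  is_class_fun <<[set: 'S_N]>>%g [ffun s : 'S_N => (-1) ^+ odd_perm s : algC].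
Proof.
apply: intro_class_fun => [s t _ _ | s]; last by rewrite mem_gen ?inE.
by rewrite odd_permJ.
Qed.
Definition sign_char (N : nat) : 'CF([set: 'S_N]) :=
  Cfun 0 (sign_is_class_fun N).

(* The irreducible character of S_N labelled by la, following James and Kerber *)
(* ("The Representation Theory of the Symmetric Group", 2.1): for a partition  *)
(* la of N, the characters induced from the trivial character of the row       *)
(* stabilizer and from the sign character of the column stabilizer have        *)
(* exactly one irreducible constituent in common. The value is 0 if la is not  *)
(* a partition of N.                                                           *)
Definition partition_char (N : nat) (la : seq nat) : 'CF([set: 'S_N]) :=
  let triv := 'Ind[[set: 'S_N], row_stab N la] 1 in
  let sgn := 'Ind[[set: 'S_N], col_stab N la] ('Res (sign_char N)) in
  if ~~ is_partition N la then 0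
  else if [pick i | (i \in irr_constt triv) && (i \in irr_constt sgn)] is Some i
       then 'chi_i else 0.

Definition immanant (R : comAlgType algC) (N : nat) (la : seq nat)
    (B : 'M[R]_N) : R :=
  \sum_(s : 'S_N) partition_char N la s *: \prod_(i < N) B i (s i).

(* The sequence (a, 1^b), or None if a or b is negative. The one exception is  *)
(* (1, 1^(-1)) = (1^0): it is the empty partition, which is what is left of    *)
(* the diagram (1, 1) once its vertical domino has been removed.               *)
Definition hook (a b : int) : option (seq nat) :=
  match a, b with
  | Posz a', Posz b' => Some (a' :: nseq b' 1%N)
  | Posz 1, Negz 0 => Some [::]
  | _, _ => None
  end.

Definition hook_immanant (R : comAlgType algC) (N : nat) (a b : int)
    (B : 'M[R]_N) : R :=
  if hook a b is Some la then immanant la B else 0.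

(* Simple graphs with vertex set 'I_n. *)
Record sgraph (n : nat) := SGraph {
  adj :> rel 'I_n;
  adj_sym : symmetric adj;
  adj_irr : irreflexive adj }.

(* An edge is represented by the ordered pair of its endpoints p.1 < p.2. *)
Definition edges (n : nat) (G : sgraph n) : {set 'I_n * 'I_n} :=
  [set p : 'I_n * 'I_n | (p.1 < p.2)%N && adj G p.1 p.2].

Definition adj_matrix (n : nat) (G : sgraph n) : 'M[algC]_n :=
  \matrix_(i, j) (adj G i j)%:R.

Section Deletion.
Variables (n : nat) (G : sgraph n) (s t : 'I_n).

Definition del_edge_rel : rel 'I_n :=
  fun i j => adj G i j && ([set i; j] != [set s; t]).

Fact del_edge_sym : symmetric del_edge_rel.
Proof. by move=> i j; rewrite /del_edge_rel adj_sym setUC. Qed.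

Fact del_edge_irr : irreflexive del_edge_rel.
Proof. by move=> i; rewrite /del_edge_rel adj_irr. Qed.

Definition del_edge : sgraph n := SGraph del_edge_sym del_edge_irr.

(* The remaining vertices are renumbered increasingly by 'I_#|~: [set s; t]|;  *)
(* this cardinal is n - 2 when s != t.                                         *)
Definition del_vertices_rel : rel 'I_#|~: [set s; t]| :=
  fun i j => adj G (enum_val i) (enum_val j).

Fact del_vertices_sym : symmetric del_vertices_rel.
Proof. by move=> i j; rewrite /del_vertices_rel adj_sym. Qed.

Fact del_vertices_irr : irreflexive del_vertices_rel.
Proof. by move=> i; rewrite /del_vertices_rel adj_irr. Qed.

Definition del_vertices : sgraph #|~: [set s; t]| :=
  SGraph del_vertices_sym del_vertices_irr.
End Deletion.

(* d_(a, 1^b) (x I_N - A(G)) as a polynomial in x = 'X; recall that            *)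
(* char_poly_mx A is the matrix 'X%:M - A over {poly algC}.                    *)
Definition hook_poly (N : nat) (a b : int) (G : sgraph N) : {poly algC} :=
  hook_immanant a b (char_poly_mx (adj_matrix G)).

Definition Phi (n k : nat) (G : sgraph n) : {poly algC} :=
  hook_poly k%:Z (n%:Z - k%:Z) G.

(* The polynomials of G - s - t for the shape (k, 1^(n-k)) with a horizontal,  *)
(* respectively vertical, domino removed.                                      *)
Definition Phi_horiz (n k : nat) (G : sgraph n) (s t : 'I_n) : {poly algC} :=
  hook_poly (k%:Z - 2) (n%:Z - k%:Z) (del_vertices G s t).
Definition Phi_vert (n k : nat) (G : sgraph n) (s t : 'I_n) : {poly algC} :=
  hook_poly k%:Z (n%:Z - k%:Z - 2) (del_vertices G s t).

(* Main.v *)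
Require Import Defs.
From mathcomp Require Import all_boot all_order all_algebra.
From mathcomp Require Import all_fingroup all_solvable all_field all_character.
From mathcomp Require Import ring zify.

(* The term of a permutation s in d_(k,1^(n-k)) (x I - A) is a constant times
   x^f, where f is the number of fixed points of s, so x d/dx multiplies it by f;
   deleting an edge kills it exactly when s uses that edge. An edge used by s is used once, except when s
   swaps its ends. Summing over the edges, the claim reduces to the terms in
   which s swaps the ends of an edge, that is to the Murnaghan-Nakayama rule for
   the removal of a 2-cycle from a hook.

   Let e_i(s) be the trace of s on the i-th exterior power of the permutation
   module, the sum over the s-stable i-subsets S of the sign of s on S. Splitting
   the stable sets according to whether they contain the swapped pair gives
   e_i(s) = e_i(s') - e_(i-2)(s'). The same recursion holds for
   h_j = e_j - e_(j-1) + ... , so it remains to see that h_j is the character of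
   (n-j, 1^j). The product <e_i, e_j> counts orbits of pairs of subsets that
   differ by at most one element on each side, and these values make h_j
   irreducible and a constituent of both e_j and e_(j+1). The two induced
   characters that define the character of (n-j, 1^j) contain e_j and e_(j+1)
   respectively, and their inner product is at most 1. *)

Set Implicit Arguments.
Unset Strict Implicit.
Unset Printing Implicit Defensive.

Import Order.TTheory GRing.Theory Num.Theory.
Local Open Scope ring_scope.

(** * Signs of restricted permutations *)

Section RestrictionSign.
Variable T : finType.
Implicit Types (S X : {set T}) (s g : {perm T}).

Lemma perm_stabP S s : reflect (s @: S = S) (s \in 'N(S | 'P)%g).
Proof.
apply: (iffP idP) => [/astabsP sS | sS].
  apply/eqP; rewrite eqEcard (card_imset _ perm_inj) leqnn andbT.
  by apply/subsetP=> _ /imsetP[x Sx ->]; rewrite -[s x]/('P%act x s) sS.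
apply/astabsP=> x /=; rewrite apermE -{1}sS.
by apply/imsetP/idP => [[y Sy /perm_inj->] // | Sx]; exists x.
Qed.

Lemma perm_stab_mem S s x : s \in 'N(S | 'P)%g -> (s x \in S) = (x \in S).
Proof. by move/astabsP=> /(_ x) /=. Qed.

Lemma restr_permEif S s x : s \in 'N(S | 'P)%g ->
  restr_perm S s x = if x \in S then s x else x.
Proof.
move=> nSs; case: ifPn => Sx; first exact: restr_permE.
exact: out_perm (restr_perm_on S s) Sx.
Qed.

Lemma stab_imset_conj S s g :
  ((s ^ g)%g \in 'N(g @: S | 'P)%g) = (s \in 'N(S | 'P)%g).
Proof.
apply/astabsP/astabsP=> sS x.
  have := sS (g x); rewrite /= !apermE permJ !(mem_imset _ _ perm_inj).
  by [].
rewrite -(permKV g x) /= !apermE permJ !(mem_imset _ _ perm_inj).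
exact: sS.
Qed.

Lemma restr_permJ S s g : s \in 'N(S | 'P)%g ->
  restr_perm (g @: S) (s ^ g)%g = (restr_perm S s ^ g)%g.
Proof.
move=> nSs; apply/permP=> x; rewrite restr_permEif ?stab_imset_conj //.
rewrite -(permKV g x) !permJ restr_permEif // mem_imset; last exact: perm_inj.
by case: ifP.
Qed.

(** Induction on the size of [S :\: X]: transposing a point of [S :\: X] with a point of [X :\: S]
    makes this difference smaller. *)
Lemma trans_subsets S X : #|S| = #|X| -> exists g, g @: S = X.
Proof.
have [m] := ubnP #|S :\: X|; elim: m S => // m IHm S leSXm eqSX.
have [sSX | /subsetPn[a Sa Xa]] := boolP (S \subset X).
  by exists 1%g; rewrite imset_perm1; apply/eqP; rewrite eqEcard sSX eqSX leqnn.
have /subsetPn[b Xb Sb]: ~~ (X \subset S).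
  apply: contra Xa => sXS.
  by have /eqP->: X == S by rewrite eqEcard sXS eqSX leqnn.
have im_t : tperm a b @: S = b |: S :\ a.
  apply/setP=> x; rewrite !inE -[x in LHS](tpermK a b) mem_imset ?perm_inj //;
    last exact: perm_inj.
  case: tpermP => [->|->|/eqP /negPf-> /eqP /negPf->]; rewrite ?eqxx //=.
    by rewrite (negPf Sb) (negPf (memPn Sb _ Sa)).
have [||g gX] := IHm (tperm a b @: S).
- rewrite im_t; apply: (leq_trans (n := #|S :\: X|)); last by rewrite -ltnS.
  apply: proper_card; apply/properP; split.
    apply/subsetP=> x; rewrite !inE => /andP[Xx /orP[/eqP xb | /andP[_ ->]]].
      by rewrite xb Xb in Xx.
    by rewrite Xx.
  exists a; rewrite !inE ?Sa ?Xa // eqxx /= orbF.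
  by rewrite (negPf (memPn Sb _ Sa)).
- by rewrite card_imset //; exact: perm_inj.
by exists (tperm a b * g)%g; rewrite -gX -imset_comp; apply: eq_imset => x; rewrite permM.
Qed.

(** The fibres of [g |-> g @: S] are cosets of the stabilizer of [S]. *)
Lemma sum_im_perm (R : nzRingType) (S : {set T}) (F : {set T} -> R) :
  \sum_(g : {perm T}) F (g @: S) =
  #|'N(S | 'P)%g|%:R * \sum_(X : {set T} | #|X| == #|S|) F X.
Proof.
rewrite (partition_big (fun g : {perm T} => g @: S) (fun X => #|X| == #|S|)) /=;
  last by move=> g _; rewrite card_imset //; exact: perm_inj.
rewrite mulr_sumr; apply: eq_bigr => X /eqP/esym/trans_subsets[h hX].
rewrite (eq_bigr (fun=> F X)) => [|g /eqP-> //].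
rewrite sumr_const mulr_natl; congr (_ *+ _).
rewrite -(card_rcoset _ h); apply: eq_card => g; rewrite mem_rcoset.
rewrite [LHS](_ : _ = (g @: S == X)) // -hX; apply/eqP/perm_stabP => gS.
  under eq_imset => x do rewrite permM.
  rewrite (imset_comp _ g) gS -imset_comp -[RHS]imset_id.
  by apply: eq_imset => x; rewrite /= permK.
by rewrite -{2}gS -imset_comp; apply: eq_imset => x; rewrite /= permM permKV.
Qed.

End RestrictionSign.

Definition set_sign (T : finType) (S : {set T}) (s : {perm T}) : algC :=
  (-1) ^+ odd_perm (restr_perm S s).

(* The trace of s on the i-th exterior power of the permutation module. *)
Definition ext_trace (T : finType) (i : nat) (s : {perm T}) : algC :=
  \sum_(S : {set T} | (#|S| == i) && (s \in 'N(S | 'P)%g)) set_sign S s.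

(** * Signs on stable subsets and orbits of pairs of subsets *)

Section SetSign.
Variable T : finType.
Implicit Types (S X Y : {set T}) (s g : {perm T}).

Lemma set_signJ S s g : s \in 'N(S | 'P)%g ->
  set_sign (g @: S) (s ^ g)%g = set_sign S s.
Proof. by move=> nSs; rewrite /set_sign restr_permJ // odd_permJ. Qed.

Lemma set_signM S : {in 'N(S | 'P)%g &,
  {morph set_sign S : s g / (s * g)%g >-> s * g}}.
Proof.
by move=> s g Ns Ng; rewrite /set_sign morphM //= odd_permM signr_addb.
Qed.

Lemma conj_set_sign S s : (set_sign S s)^* = set_sign S s.
Proof. by rewrite /set_sign rmorph_sign. Qed.

Lemma set_sign_sqr S s : set_sign S s * set_sign S s = 1.
Proof. by rewrite /set_sign -signr_addb addbb. Qed.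

Lemma tperm_stab S x y : (x \in S) = (y \in S) -> tperm x y \in 'N(S | 'P)%g.
Proof. by move=> Sxy; apply/astabsP=> z /=; rewrite apermE; case: tpermP => // ->. Qed.

Lemma restr_tperm S x y : (x \in S) = (y \in S) ->
  restr_perm S (tperm x y) = if x \in S then tperm x y else 1%g.
Proof.
move=> Sxy; apply/permP=> z; rewrite restr_permEif ?tperm_stab //.
case: (boolP (x \in S)) => Sx; case: ifP => Sz; rewrite ?perm1 //.
  by rewrite tpermD //; apply: contraFneq Sz => <- //; rewrite -Sxy.
by rewrite tpermD //; apply: contraTneq Sz => <- //; rewrite -Sxy.
Qed.

Lemma set_sign_tperm S x y : (x \in S) = (y \in S) ->
  set_sign S (tperm x y) = (-1) ^+ ((x != y) && (x \in S)).
Proof.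
move=> Sxy; rewrite /set_sign restr_tperm //.
by case: ifP; rewrite ?odd_tperm ?odd_perm1 ?andbT ?andbF.
Qed.

(** These are the pairs for which the two signs agree on the whole common stabilizer. *)
Definition near_sets S X := (#|S :\: X| <= 1)%N && (#|X :\: S| <= 1)%N.

Lemma stab_fix_small S s x : s \in 'N(S | 'P)%g -> (#|S| <= 1)%N -> x \in S ->
  s x = x.
Proof. by move=> nS /card_le1P S1 Sx; apply/eqP; rewrite -[_ == _](S1 x Sx) perm_stab_mem. Qed.

(** A permutation that stabilizes both sets stabilizes their differences, hence fixes them
    pointwise, and its restrictions to [S] and to [X] coincide. *)
Lemma set_sign_near S X s : near_sets S X ->
  s \in 'N(S | 'P)%g -> s \in 'N(X | 'P)%g -> set_sign S s = set_sign X s.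
Proof.
case/andP=> SX XS nS nX; rewrite /set_sign; congr (_ ^+ odd_perm _).
have nD Y Z : s \in 'N(Y | 'P)%g -> s \in 'N(Z | 'P)%g -> s \in 'N(Y :\: Z | 'P)%g.
  by move=> nY nZ; apply/astabsP=> x /=; rewrite !inE apermE !perm_stab_mem.
apply/permP=> x; rewrite !restr_permEif //.
case: ifPn => Sx; case: ifPn => Xx //.
  by rewrite (stab_fix_small (nD _ _ nS nX)) // !inE Sx Xx.
by rewrite (stab_fix_small (nD _ _ nX nS)) // !inE Sx Xx.
Qed.

(* A transposition inside the large difference reverses the sign of each term. *)
Lemma sum_set_sign_far S X : ~~ near_sets S X ->
  \sum_(s in 'N(S | 'P)%g | s \in 'N(X | 'P)%g) set_sign S s * set_sign X s = 0.
Proof.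
wlog SX: S X / (1 < #|S :\: X|)%N.
  move=> IH; rewrite negb_and -!ltnNge => /orP[] far.
    by apply: IH; rewrite // negb_and -!ltnNge far.
  rewrite -[RHS](IH X S) //; last by rewrite negb_and -!ltnNge far.
  by apply: eq_big => s; rewrite 1?andbC // mulrC.
move=> _; have [x [y [Sx Sy /eqP xy]]] := card_gt1P SX.
move: Sx Sy; rewrite !inE => /andP[Xx Sx] /andP[Xy Sy].
have nS : tperm x y \in 'N(S | 'P)%g by rewrite tperm_stab // Sx.
have nX : tperm x y \in 'N(X | 'P)%g by rewrite tperm_stab // (negPf Xx) (negPf Xy).
set F := (X in X = 0); suff : F = - F.
  by move=> FN; apply/eqP; rewrite -eqNr -FN.
rewrite {1}/F (reindex_inj (mulgI (tperm x y))) /= -sumrN.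
apply: eq_big => s; first by rewrite !groupMl.
rewrite !groupMl // => /andP[sS sX]; rewrite !set_signM //.
rewrite !set_sign_tperm ?Sx ?Sy ?(negPf Xx) ?(negPf Xy) // andbF.
by move/eqP: xy => ->; rewrite expr0 mul1r expr1 mulN1r mulNr.
Qed.

Lemma sum_set_sign S X :
  \sum_(s in 'N(S | 'P)%g | s \in 'N(X | 'P)%g) set_sign S s * set_sign X s =
  #|'N(S | 'P)%g :&: 'N(X | 'P)%g|%:R *+ near_sets S X.
Proof.
case: (boolP (near_sets S X)) => [SX | /sum_set_sign_far->]; last by rewrite mulr0n.
rewrite mulr1n -sum1_card natr_sum; apply: eq_big => s; first by rewrite in_setI.
by case/andP=> nS nX; rewrite (set_sign_near SX) // set_sign_sqr.
Qed.

(** The hypotheses make [P] empty or a single orbit of [H]; on an orbit, the orders of the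
    stabilizers add up to the order of [H]. *)
Lemma sum_stab_orbit (H : {group {perm T}}) (P : pred {set T}) :
    (forall X h, P X -> h \in H -> P (h @: X)) ->
    (forall X Y, P X -> P Y -> exists2 h, h \in H & h @: X = Y) ->
  (\sum_(X | P X) #|H :&: 'N(X | 'P)%g| = if [exists X, P X] then #|H| else 0)%N.
Proof.
move=> actP trP; case: existsP => [[X0 PX0] | noP]; last first.
  by rewrite big1 // => X PX; case: noP; exists X.
have im X h : 'P^*%act X h = h @: X by [].
have stab1 X : 'C_H[X | 'P^*]%g = H :&: 'N(X | 'P)%g by rewrite astab1_set.
have orbP X : P X -> orbit 'P^* H X = [set Y | P Y].
  move=> PX; apply/setP=> Y; rewrite inE; apply/imsetP/idP => [[h Hh ->] | PY].
    by rewrite im; exact: actP.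
  by have [h Hh hX] := trP X Y PX PY; exists h; rewrite // im.
have cst X : P X -> (#|[set Y | P Y]| * #|H :&: 'N(X | 'P)%g| = #|H|)%N.
  by move=> PX; rewrite -(orbP X PX) -stab1 card_orbit_stab.
rewrite (eq_bigr (fun=> #|H :&: 'N(X0 | 'P)%g|)) => [|X PX].
  by rewrite sum_nat_const -(cst X0 PX0); congr (_ * _)%N; apply: eq_card => X; rewrite inE.
apply/eqP; rewrite -(@eqn_pmul2l #|[set Y | P Y]|) ?cst //.
by apply/card_gt0P; exists X0; rewrite inE.
Qed.

Definition diff_sizes S (p q : bool) X := (#|S :\: X| == p) && (#|X :\: S| == q).

Lemma trans_small_subsets S X Y : X \subset S -> Y \subset S ->
    #|X| = #|Y| -> (#|X| <= 1)%N ->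
  exists2 h, perm_on S h & h @: X = Y.
Proof.
move=> sXS sYS eqXY; rewrite leq_eqVlt ltnS leqn0 => /orP[X1 | X0].
  move: (X1); rewrite eqXY => /cards1P[y Yy]; case/cards1P: X1 => x Xx.
  exists (tperm x y); last by rewrite Xx Yy imset_set1 tpermL.
  apply/subsetP=> z; rewrite inE; case: tpermP => [-> _|-> _|_ _ /eqP//].
    by rewrite (subsetP sXS) // Xx set11.
  by rewrite (subsetP sYS) // Yy set11.
have /eqP-> : X == set0 by rewrite -cards_eq0.
have /eqP-> : Y == set0 by rewrite -cards_eq0 -eqXY.
by exists 1%g; rewrite ?perm_on1 ?imset0.
Qed.

(** The parts inside and outside [S] are moved separately, by [h1] supported in [S] and [h2]
    supported in its complement. *)
Lemma diff_sizes_trans S p q X Y : diff_sizes S p q X -> diff_sizes S p q Y ->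
  exists2 h, h \in 'N(S | 'P)%g & h @: X = Y.
Proof.
case/andP=> /eqP Xp /eqP Xq /andP[/eqP Yp /eqP Yq].
have [||||h1 S1 h1X] := @trans_small_subsets S (S :\: X) (S :\: Y);
  rewrite ?subsetDl ?Xp ?Yp ?leq_b1 //.
have [||||h2 S2 h2X] := @trans_small_subsets (~: S) (X :\: S) (Y :\: S);
  rewrite ?Xq ?Yq ?leq_b1 // ?setDE ?subsetIr //.
have h_in x : x \in S -> (h1 * h2)%g x = h1 x.
  by move=> Sx; rewrite permM (out_perm S2) // !inE negbK (perm_closed _ S1).
have h_out x : x \notin S -> (h1 * h2)%g x = h2 x.
  by move=> Sx; rewrite permM (out_perm S1).
have memS x : ((h1 * h2)%g x \in S) = (x \in S).
  case: (boolP (x \in S)) => Sx; first by rewrite h_in // (perm_closed _ S1).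
  rewrite h_out //; have := perm_closed x S2; rewrite !inE (negPf Sx).
  by case: (_ \in S).
exists (h1 * h2)%g; first by apply/astabsP=> x /=; rewrite apermE memS.
apply/setP=> y; rewrite -[y in LHS](permKV (h1 * h2)%g).
rewrite -[y in RHS](permKV (h1 * h2)%g) mem_imset; last exact: perm_inj.
move: (_ y) => x; case: (boolP (x \in S)) => Sx.
  rewrite h_in //; have : (h1 x \in S :\: Y) = (x \in S :\: X).
    by rewrite -h1X mem_imset //; exact: perm_inj.
  by rewrite !inE (perm_closed _ S1) Sx !andbT => /negb_inj.
rewrite h_out //; have : (h2 x \in Y :\: S) = (x \in X :\: S).
  by rewrite -h2X setDE mem_imset //; exact: perm_inj.
have := perm_closed x S2; rewrite !inE (negPf Sx) /= => /negbTE.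
by case: (_ \in S) => //=.
Qed.

Lemma diff_sizes_stab S p q X h : diff_sizes S p q X -> h \in 'N(S | 'P)%g ->
  diff_sizes S p q (h @: X).
Proof.
move=> Xpq /perm_stabP hS; rewrite /diff_sizes -{1 2}hS.
by rewrite -!preim_permV -!preimsetD !preim_permV !card_imset //; exact: perm_inj.
Qed.

Lemma diff_sizes_exists S (p q : bool) :
  [exists X, diff_sizes S p q X] = (p <= #|S|)%N && (#|S| + q <= #|T|)%N.
Proof.
apply/existsP/andP => [[X /andP[/eqP <- /eqP <-]] | []].
  rewrite subset_leq_card ?subsetDl //; split=> //.
  by rewrite -[#|T|](cardsC S) leq_add2l subset_leq_card // setDE subsetIr.
rewrite -[#|T|](cardsC S) leq_add2l => pS qS.
have sub1 (b : bool) (A : {set T}) : (b <= #|A|)%N ->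
    exists2 B : {set T}, B \subset A & #|B| = b.
  case: b => [/card_gt0P[x Ax] | _]; last by exists set0; rewrite ?sub0set ?cards0.
  by exists [set x]; rewrite ?sub1set ?cards1.
have [[B1 sB1 cB1] [B2 sB2 cB2]] := (sub1 _ _ pS, sub1 _ _ qS).
exists (S :\: B1 :|: B2); rewrite /diff_sizes -cB1 -cB2; apply/andP; split; apply/eqP.
  apply: eq_card => x; have /implyP := subsetP sB1 x.
  have /implyP := subsetP sB2 x; rewrite !inE.
  by case: (x \in S) (x \in B1) (x \in B2) => [] [] [].
apply: eq_card => x; have /implyP := subsetP sB1 x.
have /implyP := subsetP sB2 x; rewrite !inE.
by case: (x \in S) (x \in B1) (x \in B2) => [] [] [].
Qed.

(** The near sets fall into four classes indexed by [p] and [q], each empty or one orbit of the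
    stabilizer of [S]; [sizes] tells which classes consist of sets of size [j]. *)
Lemma sum_near_stab S j :
  (\sum_(X : {set T} | (#|X| == j) && near_sets S X) #|'N(S | 'P)%g :&: 'N(X | 'P)%g| =
   #|'N(S | 'P)%g| * \sum_(p : bool) \sum_(q : bool)
     [&& #|S| + q == j + p, p <= #|S| & #|S| + q <= #|T|])%N.
Proof.
have sizes (X : {set T}) : (#|X| + #|S :\: X| = #|S| + #|X :\: S|)%N.
  by rewrite -(cardsID X S) -(cardsID S X) setIC addnAC.
transitivity (\sum_(p : bool) \sum_(q : bool) \sum_(X | diff_sizes S p q X)
   (#|S| + q == j + p) * #|'N(S | 'P)%g :&: 'N(X | 'P)%g|)%N.
  under [RHS]eq_bigr => p _.
    under eq_bigr => q _ do rewrite big_mkcond /=.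
    rewrite exchange_big /=; over.
  rewrite exchange_big big_mkcond /=; apply: eq_bigr => X _.
  rewrite !big_bool /near_sets /diff_sizes; have := sizes X.
  case: #|S :\: X| => [|[|p]]; case: #|X :\: S| => [|[|q]] => //=;
    rewrite ?andbF ?andbT // ?(addn0, addn1) ?add0n => eqX;
    rewrite -?eqX ?eqSS -?eqX ?eqSS; by case: (#|X| == j); rewrite /= ?mul1n ?mul0n ?addn0 ?add0n.
rewrite big_distrr /=; apply: eq_bigr => p _.
rewrite big_distrr /=; apply: eq_bigr => q _; rewrite -big_distrr /=.
rewrite sum_stab_orbit => [|X h|X Y].
- rewrite diff_sizes_exists.
  by case: (_ == _); case: (_ && _); rewrite /= ?mul1n ?mul0n ?muln0 ?muln1.
- exact: diff_sizes_stab.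
exact: diff_sizes_trans.
Qed.

End SetSign.

(** * Exterior powers of the permutation character *)

Section ExteriorCharacters.
Variable N : nat.
Local Notation G := [set: 'S_N]%G.
Implicit Types (S X : {set 'I_N}) (s g : 'S_N) (i j : nat).

Lemma sign_charE s : sign_char N s = (-1) ^+ odd_perm s.
Proof. by rewrite cfunE. Qed.

Lemma sign_char_lin : sign_char N \is a linear_char.
Proof.
have sgn_repr : mx_repr G (fun s => ((-1) ^+ odd_perm s)%:M : 'M[algC]_1).
  split=> [|s g _ _]; first by rewrite odd_perm1.
  by rewrite odd_permM signr_addb scalar_mxM.
rewrite qualifE /= sign_charE odd_perm1 eqxx andbT.
suff -> : sign_char N = cfRepr (MxRepresentation sgn_repr) by exact: cfRepr_char.
by apply/cfun_inP=> s _; rewrite sign_charE cfunE inE mulr1n /= mxtrace_scalar.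
Qed.

(** As a pullback of the sign character along the morphism [restr_perm S], this is a linear
    character at once. *)
Definition set_sign_cfun S : 'CF('N(S | 'P)%g) :=
  cfMorph ('Res[restr_perm S @* 'N(S | 'P)] (sign_char N)).

Lemma set_sign_cfun_lin S : set_sign_cfun S \is a linear_char.
Proof. by rewrite cfMorph_lin_char ?cfRes_lin_char ?sign_char_lin. Qed.

Lemma set_sign_cfunE S s : s \in 'N(S | 'P)%g -> set_sign_cfun S s = set_sign S s.
Proof.
move=> nSs; rewrite cfMorphE // cfResE ?subsetT ?mem_morphim //.
exact: sign_charE.
Qed.

(** The exterior power of degree [#|S|] has a basis indexed by subsets, permuted transitively up to
    sign, so its character is induced from the stabilizer of one basis line. *)
Definition ext_cfun S : 'CF(G) := 'Ind[G] (set_sign_cfun S).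

Lemma ext_cfun_char S : ext_cfun S \is a character.
Proof. by rewrite cfInd_char // lin_charW ?set_sign_cfun_lin. Qed.

Lemma ext_cfunE S s : ext_cfun S s = ext_trace #|S| s.
Proof.
rewrite cfIndE ?subsetT //.
pose F X := if s \in 'N(X | 'P)%g then set_sign X s else 0.
(* After [g] is replaced by its inverse, the condition that a conjugate of [s] stabilizes [S] says
   that [s] stabilizes [g @: S]. *)
rewrite (reindex_inj invg_inj) /=.
rewrite (eq_bigr (fun g => F (g @: S))) => [|g _]; last first.
  rewrite /F; have eS : s = ((s ^ g^-1) ^ g)%g by rewrite -conjgM mulVg conjg1.
  rewrite [in RHS]eS stab_imset_conj; case: ifP => nS.
    by rewrite set_sign_cfunE // set_signJ.
  by rewrite cfun0 ?nS.
rewrite (eq_bigl xpredT) => [|g]; last by rewrite inE.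
rewrite sum_im_perm mulKf ?pnatr_eq0 -?lt0n ?cardG_gt0 //.
by rewrite /ext_trace big_mkcondr.
Qed.

Lemma eq_ext_cfun S X : #|S| = #|X| -> ext_cfun S = ext_cfun X.
Proof. by move=> eqSX; apply/cfunP=> s; rewrite !ext_cfunE eqSX. Qed.

(** Frobenius reciprocity moves the product to the stabilizer of [S]; exchanging the sums leaves,
    for each [Y] of the size of [X], the sum computed in [sum_set_sign]. *)
Lemma cfdot_ext S X : '[ext_cfun S, ext_cfun X] =
  (\sum_(p : bool) \sum_(q : bool)
     [&& #|S| + q == #|X| + p, p <= #|S| & #|S| + q <= N])%N%:R.
Proof.
rewrite -Frobenius_reciprocity cfdotE.
under eq_bigr => s nSs.
  rewrite set_sign_cfunE // cfResE ?subsetT // ext_cfunE rmorph_sum mulr_sumr.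
  rewrite (eq_bigr (fun Y => set_sign S s * set_sign Y s)) => [|Y _].
    over.
  by congr (_ * _); exact: conj_set_sign.
rewrite /= (exchange_big_dep (fun Y : {set 'I_N} => #|Y| == #|X|)) /= => [|s Y _ /andP[] //].
under eq_bigr => Y cY.
  under eq_bigl => s do rewrite cY /=.
  rewrite sum_set_sign mulrb; over.
rewrite -big_mkcondr /= -natr_sum sum_near_stab card_ord natrM mulKf //.
by rewrite pnatr_eq0 -lt0n cardG_gt0.
Qed.

End ExteriorCharacters.

(** * Hook characters *)

(* The character of the hook (n-j, 1^j), as the alternating sum obtained from
   ext_trace j = hook_trace j + hook_trace (j-1). *)
Fixpoint hook_trace (T : finType) (j : nat) (s : {perm T}) : algC :=
  ext_trace j s - (if j is i.+1 then hook_trace i s else 0).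

Section HookCharacters.
Variable N : nat.
Local Notation G := [set: 'S_N]%G.
Implicit Types (A B S X : {set 'I_N}) (s g : 'S_N) (i j : nat).

Definition first_ords i : {set 'I_N} := [set x : 'I_N | (x < i)%N].

Lemma card_first_ords i : (i <= N)%N -> #|first_ords i| = i.
Proof.
move=> le_iN; rewrite -[RHS]card_ord -[RHS](card_codom (f := widen_ord le_iN)) //.
  apply: eq_card => x; rewrite inE; apply/idP/codomP => [lt_xi | [y ->]].
    by exists (Ordinal lt_xi); exact: val_inj.
  exact: (ltn_ord y).
by move=> x y /(congr1 val) /= /val_inj.
Qed.

(** The counterpart of [hook_trace] as a class function, meant for [j <= N]: beyond that
    [first_ords j] no longer has [j] elements. *)
Fixpoint hook_cfun j : 'CF(G) :=
  ext_cfun (first_ords j) - (if j is i.+1 then hook_cfun i else 0).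

Lemma hook_cfunE j s : (j <= N)%N -> hook_cfun j s = hook_trace j s.
Proof.
elim: j => [|j IHj] ltjN; rewrite /= !cfunE ext_cfunE card_first_ords //.
by rewrite IHj // ltnW.
Qed.

Lemma hook_cfun_vchar j : hook_cfun j \in 'Z[irr G]%g.
Proof.
elim: j => [|j IHj] /=; first by rewrite subr0 char_vchar ?ext_cfun_char.
by rewrite rpredB // char_vchar ?ext_cfun_char.
Qed.

Lemma cfdot_ext_first i j : (i <= N)%N -> (j <= N)%N ->
  '[ext_cfun (first_ords i), ext_cfun (first_ords j)] =
  (\sum_(p : bool) \sum_(q : bool) [&& i + q == j + p, p <= i & i + q <= N])%N%:R.
Proof. by move=> iN jN; rewrite cfdot_ext !card_first_ords. Qed.

(** Only [p = q] preserves the size, and [p = q = 1] requires a point inside and a point outside the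
    set. *)
Lemma cfnorm_ext i : (i <= N)%N ->
  '[ext_cfun (first_ords i)] = ((0 < i) && (i < N)).+1%N%:R.
Proof.
move=> iN; rewrite cfdot_ext_first // !big_bool /= !addn0 !addn1 !eqxx iN.
by rewrite (ltn_eqF (leqnn _)) (gtn_eqF (leqnn _)) /= addn0 add0n addn1.
Qed.

Lemma cfdot_extS i : (i < N)%N ->
  '[ext_cfun (first_ords i), ext_cfun (first_ords i.+1)] = 1.
Proof.
move=> iN; rewrite cfdot_ext_first ?(ltnW iN) // !big_bool /= !addn0 !addn1.
by rewrite eqxx iN eqSS !(@ltn_eqF i) //= addn0 add0n.
Qed.

Lemma cfdot_ext_far i j : (i.+1 < j)%N -> (j <= N)%N ->
  '[ext_cfun (first_ords i), ext_cfun (first_ords j)] = 0.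
Proof.
move=> ij jN; rewrite cfdot_ext_first //; last exact: leq_trans (ltnW (ltnW ij)) jN.
rewrite !big_bool /= !addn0 !addn1.
by rewrite !ltn_eqF // ?eqSS ?ltnS ltnW // ltnW.
Qed.

(** Only the top term [j] of the alternating sum can have a degree within one of [i]. *)
Lemma cfdot_hook_ext j i : (j < i)%N -> (i <= N)%N ->
  '[hook_cfun j, ext_cfun (first_ords i)] = (i == j.+1)%:R.
Proof.
elim: j i => [|j IHj] i ji iN /=.
  rewrite subr0; move: ji; rewrite leq_eqVlt => /orP[/eqP i1 | i2].
    by subst i; rewrite cfdot_extS // eqxx.
  by rewrite cfdot_ext_far // gtn_eqF.
rewrite cfdotBl IHj ?(ltnW ji) // (gtn_eqF ji) subr0.
move: ji; rewrite leq_eqVlt => /orP[/eqP i1 | i2].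
  by subst i; rewrite cfdot_extS // eqxx.
by rewrite cfdot_ext_far // gtn_eqF.
Qed.

(** Expanding the norm of e_(j+1) - h_j gives 2 + 1 - 2 when [j.+1 < N], and 1 + 1 - 2 when
    [j.+1 = N]. *)
Lemma cfnorm_hook j : (0 < N)%N -> (j <= N)%N -> '[hook_cfun j] = (j < N)%:R.
Proof.
move=> N0; elim: j => [|j IHj] jN /=.
  by rewrite subr0 cfnorm_ext // N0.
rewrite cfnormB IHj ?(ltnW jN) // jN (cfdotC (ext_cfun _) (hook_cfun j)).
rewrite cfdot_hook_ext // eqxx cfnorm_ext //= !conjC1.
by case: (_ < N)%N; rewrite /= ?mulr1n; ring.
Qed.

Lemma hook_cfunN : (0 < N)%N -> hook_cfun N = 0.
Proof. by move=> N0; apply/eqP; rewrite -cfnorm_eq0 cfnorm_hook // ltnn. Qed.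

(** A virtual character of norm 1 is irreducible up to sign; the product 1 with the character
    e_(j+1) excludes the negative sign. *)
Lemma hook_cfun_irr j : (j < N)%N -> exists i : Iirr G, hook_cfun j = 'chi_i.
Proof.
move=> jN; have N0 := leq_ltn_trans (leq0n j) jN.
have /(vchar_norm1P (hook_cfun_vchar j))[b [i eq_i]] : '[hook_cfun j] = 1.
  by rewrite cfnorm_hook ?jN // ltnW.
exists i; rewrite eq_i; case: b eq_i => eq_i; last by rewrite scale1r.
have := cfdot_hook_ext (leqnn j.+1) jN; rewrite eqxx eq_i scaleN1r cfdotNl => /eqP.
have := Cnat_cfdot_char_irr i (ext_cfun_char (first_ords j.+1)).
rewrite cfdotC => /natr_ge0; rewrite conjC_ge0 -oppr_le0 => le0 /eqP eq1.
by rewrite eq1 ler10 in le0.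
Qed.

Lemma cfdot_hook_ext_diag j : (j < N)%N ->
  '[hook_cfun j, ext_cfun (first_ords j)] = 1.
Proof.
case: j => [|j] jN /=; first by rewrite subr0 cfnorm_ext.
have jN' := ltnW jN.
by rewrite cfdotBl cfnorm_ext // jN cfdot_hook_ext // eqxx addrK.
Qed.

(** By Frobenius reciprocity, [phi] occurs in the restriction of ['chi_i] to [Y], so its restriction
    occurs in that of ['chi_i] to [H]. *)
Lemma constt_Ind_Res_lin (Y H : {group 'S_N}) (phi : 'CF(Y)) (i : Iirr G) :
    H \subset Y -> phi \is a linear_char ->
  i \in irr_constt ('Ind[G] phi) -> i \in irr_constt ('Ind[G] ('Res[H] phi)).
Proof.
move=> sHY lin_phi; have /irrP[m phi_m] := lin_char_irr lin_phi.
have /irrP[l res_l] := lin_char_irr (cfRes_lin_char H lin_phi).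
rewrite res_l phi_m !constt_Ind_Res => im.
rewrite -(cfResRes 'chi_i sHY (subsetT _)).
apply: (constt_Res_trans _ im); first by rewrite cfRes_char ?irr_char.
by rewrite -phi_m res_l constt_irr inE.
Qed.

End HookCharacters.

(** * Hook characters as common constituents for the row and column stabilizers *)

Section HookConstituents.
Variable N : nat.
Local Notation G := [set: 'S_N]%G.
Implicit Types (A B S X : {set 'I_N}) (s g : 'S_N) (i j k : nat).

Lemma sub_Sym_stab A S : A \subset S -> perm.Sym A \subset 'N(S | 'P)%g.
Proof.
move=> sAS; apply/subsetP=> s; rewrite inE => As; apply/astabsP=> x /=.
rewrite apermE; case: (boolP (x \in A)) => Ax; last by rewrite (out_perm As).
by rewrite !(subsetP sAS) // (perm_closed _ As).
Qed.

Lemma sub_Sym_stabC A S : A \subset ~: S -> perm.Sym A \subset 'N(S | 'P)%g.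
Proof.
move/sub_Sym_stab/subset_trans; apply; apply/subsetP=> s /astabsP sS.
by apply/astabsP=> x; apply: negb_inj; have := sS x; rewrite !inE.
Qed.

(** [Sym A] fixes [~: A] pointwise, so the sign on [~: A] is trivial on it. *)
Lemma constt_ext_Ind_Sym1 A (i : Iirr G) :
  i \in irr_constt (ext_cfun (~: A)) -> i \in irr_constt ('Ind[G, perm.Sym_group A] 1).
Proof.
have sAN : perm.Sym A \subset 'N(~: A | 'P)%g by rewrite sub_Sym_stabC ?setCK.
move/(constt_Ind_Res_lin (H := perm.Sym_group A) sAN (set_sign_cfun_lin _)).
suff -> : 'Res[perm.Sym_group A] (set_sign_cfun (~: A)) = 1 by [].
apply/cfun_inP=> s As; have nAs := subsetP sAN s As.
rewrite cfResE // set_sign_cfunE // cfun1E As /set_sign.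
suff -> : restr_perm (~: A) s = 1%g by rewrite odd_perm1.
apply/permP=> x; rewrite restr_permEif // perm1; case: ifP => //.
by rewrite inE => Ax; move: As; rewrite inE => /out_perm->.
Qed.

(** On [Sym B] the sign on [B] is the full sign. *)
Lemma constt_ext_Ind_Sym_sign B (i : Iirr G) :
  i \in irr_constt (ext_cfun B) ->
  i \in irr_constt ('Ind[G, perm.Sym_group B] ('Res (sign_char N))).
Proof.
have sBN : perm.Sym B \subset 'N(B | 'P)%g by exact: sub_Sym_stab.
move/(constt_Ind_Res_lin (H := perm.Sym_group B) sBN (set_sign_cfun_lin _)).
suff -> : 'Res[perm.Sym_group B] (set_sign_cfun B) = 'Res (sign_char N) by [].
apply/cfun_inP=> s Bs; have nBs := subsetP sBN s Bs.
rewrite !cfResE ?subsetT // set_sign_cfunE // sign_charE /set_sign.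
suff -> : restr_perm B s = s by [].
apply/permP=> x; rewrite restr_permEif //; case: ifPn => // Bx.
by move: Bs; rewrite inE => /out_perm->.
Qed.

(** For a row [A] and a column [B]: after [g] the column meets the row at most once. *)
Definition transverse A B g := (#|[set x in B | g x \in A]| <= 1)%N.

(** In the transverse case only the identity contributes, since a point moved by [c] and its image
    would be two points of [B] sent into [A]. Otherwise the transposition of two such points cancels
    the terms in pairs. *)
Lemma sum_sign_conj_Sym A B g :
  \sum_(c in perm.Sym B | (c ^ g)%g \in perm.Sym A) sign_char N c = (transverse A B g)%:R.
Proof.
case: (boolP (transverse A B g)) => [/card_le1_eqP inj_g | ].
  rewrite (big_pred1 1%g) => [|c]; first by rewrite sign_charE odd_perm1.
  rewrite !inE; apply/andP/eqP => [[Bc Ac] | ->]; last by rewrite conj1g !perm_on1.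
  apply/permP=> x; rewrite perm1; apply/eqP; apply: contraT => cx.
  have Bx : x \in B by apply: contraR cx => /(out_perm Bc)->.
  have A_of y : c y != y -> g y \in A.
    move=> cy; apply: contraR cy => Ay; have := out_perm Ac Ay.
    by rewrite permJ => /perm_inj->.
  have ccx : c (c x) != c x by rewrite (inj_eq perm_inj).
  have := inj_g x (c x); rewrite !inE (perm_closed _ Bc) Bx !A_of // => /(_ isT isT) eqcx.
  by rewrite eqcx eqxx in cx.
rewrite -ltnNge => /card_gt1P[x [y []]]; rewrite !inE => /andP[Bx Ax] /andP[By Ay] xy.
have Bt : tperm x y \in perm.Sym B.
  by rewrite inE; apply/subsetP=> z; rewrite inE; case: tpermP => [->|->|_ _ /eqP].
have At : (tperm x y ^ g)%g \in perm.Sym A.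
  by rewrite tpermJ inE; apply/subsetP=> z; rewrite inE; case: tpermP => [->|->|_ _ /eqP].
set F := (X in X = _); suff : F = - F.
  by move=> FN; apply/eqP; rewrite -eqNr -FN.
rewrite {1}/F (reindex_inj (mulgI (tperm x y))) /= -sumrN.
apply: eq_big => c.
  by rewrite conjMg (groupMl (G := perm.Sym_group B) _ Bt)
    (groupMl (G := perm.Sym_group A) _ At).
by rewrite !sign_charE odd_mul_tperm xy signr_addb mulN1r.
Qed.

(* A transverse g lies in Sym B * Sym A: move each point of ~: A back into place
   by an element of Sym B. *)
Lemma card_transverse A B : ~: A \subset B -> (#|A| + #|B| = N.+1)%N ->
  (#|[set g | transverse A B g]| <= #|perm.Sym B| * #|perm.Sym A|)%N.
Proof.
move=> sAB cAB; have [z Az Bz] : exists2 z, z \in A & z \in B.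
  apply/exists_inP; apply: contraLR sAB => /exists_inPn noz.
  apply/negP => sAB; have := cardsC A; rewrite card_ord.
  have -> : ~: A = B; last by lia.
  apply/eqP; rewrite eqEsubset sAB; apply/subsetP=> x Bx; rewrite inE.
  by apply/negP=> /noz; rewrite Bx.
apply: leq_trans (_ : #|(perm.Sym_group B * perm.Sym_group A)%g| <= _)%N; last first.
  by rewrite mul_cardG leq_pmulr // cardG_gt0.
apply: subset_leq_card; apply/subsetP=> g; rewrite inE => tg.
(* [B] has one point more than [~: A], and [g] sends at most one point of [B] into [A]; the
   remaining ones already exhaust the preimage of [~: A]. *)
have gB x : g x \notin A -> x \in B.
  suff /setP/(_ x) : [set x in B | g x \notin A] = g @^-1: (~: A).
    by rewrite !inE => eqx Ax; move: eqx; rewrite Ax => /andP[].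
  apply/eqP; rewrite eqEcard; apply/andP; split.
    by apply/subsetP=> y; rewrite !inE => /andP[].
  rewrite card_preimset; last exact: perm_inj.
  have := cardsC A; have := cardsID (g @^-1: A) B; rewrite card_ord.
  have -> : B :&: g @^-1: A = [set x in B | g x \in A] by apply/setP=> y; rewrite !inE.
  have -> : B :\: g @^-1: A = [set x in B | g x \notin A].
    by apply/setP=> y; rewrite !inE andbC.
  by move: tg; rewrite /transverse; lia.
(* [f] copies [g] on [B], except that the point sent into [A] goes to [z] in order to stay in [B];
   then [f^-1] followed by [g] fixes [~: A] pointwise. *)
pose f x := if x \in B then if g x \in A then z else g x else x.
have fB x : (f x \in B) = (x \in B).
  rewrite /f; case: ifP => // Bx; case: ifPn => // Agx.
  by rewrite (subsetP sAB) // inE.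
have f_inj : injective f.
  move=> x y eq_f; have := fB x; rewrite eq_f fB => eqB.
  move: eq_f; rewrite /f eqB; case: (boolP (x \in B)) => // Bx.
  rewrite Bx in eqB; case: ifPn => Ax; case: ifPn => Ay.
  - by move=> _; apply: (card_le1_eqP tg); rewrite inE ?Bx ?eqB.
  - by move=> ez; rewrite -ez Az in Ay.
  - by move=> ez; rewrite ez Az in Ax.
  - by move/perm_inj.
have Bf : perm f_inj \in perm.Sym_group B.
  by rewrite inE; apply/subsetP=> x; rewrite inE permE; apply: contraR; rewrite /f => /negPf->.
apply/mulsgP; exists (perm f_inj) ((perm f_inj)^-1 * g)%g; rewrite ?mulKVg //.
rewrite inE; apply/subsetP=> y; rewrite inE; apply: contraR => Ay.
have -> : y = perm f_inj (g^-1 y)%g.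
  by rewrite permE /f gB permKV // (negPf Ay).
by rewrite permM permK permKV permE /f gB permKV // (negPf Ay).
Qed.

(** Reciprocity and the formula for induced characters turn the product into the number of
    transverse permutations divided by the orders of [Sym A] and [Sym B]. *)
Lemma cfdot_Ind_Sym A B : ~: A \subset B -> (#|A| + #|B| = N.+1)%N ->
  '['Ind[G, perm.Sym_group A] 1, 'Ind[G, perm.Sym_group B] ('Res (sign_char N))] <= 1.
Proof.
move=> sAB cAB; rewrite -cfdot_Res_l cfdotE.
under eq_bigr => c Bc.
  rewrite !cfResE ?subsetT // cfIndE ?subsetT // -mulrA mulr_suml.
  rewrite (eq_bigr (fun g => if (c ^ g)%g \in perm.Sym A then sign_char N c else 0)).
    over.
  move=> g _; rewrite cfun1E sign_charE rmorph_sign.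
  by case: (_ \in _); rewrite ?mul1r ?mul0r.
rewrite -mulr_sumr exchange_big /=.
under eq_bigr => g _ do rewrite -big_mkcondr sum_sign_conj_Sym /=.
rewrite -natr_sum.
have -> : (\sum_(g in G) transverse A B g = #|[set g | transverse A B g]|)%N.
  rewrite -sum1_card [RHS]big_mkcond [LHS]big_mkcond.
  by apply: eq_bigr => g _; rewrite !inE; case: (transverse A B g).
rewrite mulrA -invfM -natrM ler_pdivrMl; last by rewrite ltr0n muln_gt0 !cardG_gt0.
by rewrite mulr1 ler_nat card_transverse.
Qed.

Lemma common_constt_unique (phi psi : 'CF(G)) (i m : Iirr G) :
    phi \is a character -> psi \is a character -> '[phi, psi] <= 1 ->
    i \in irr_constt phi -> i \in irr_constt psi ->
    m \in irr_constt phi -> m \in irr_constt psi ->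
  i = m.
Proof.
move=> Cphi Cpsi le1 i_phi i_psi m_phi m_psi; apply/eqP; apply: contraTT le1 => neq_im.
have ge1 chi l : chi \is a character -> l \in irr_constt chi -> 1 <= '[chi, 'chi[G]_l].
  move=> Cchi; rewrite irr_consttE; have /natrP[c ->] := Cnat_cfdot_char_irr l Cchi.
  by rewrite pnatr_eq0 ler1n lt0n.
have ge0 chi l : chi \is a character -> 0 <= '[chi, 'chi[G]_l].
  by move=> Cchi; rewrite natr_ge0 // Cnat_cfdot_char_irr.
rewrite cfdot_char_r // (bigD1 i) //= (bigD1 m) 1?eq_sym //= addrA.
apply/negP => le1; have : 1 + 1 + 0 <= 1 :> algC.
  apply: le_trans le1; apply: lerD; first by apply: lerD; apply: mulr_ege1; apply: ge1.
  by apply: sumr_ge0 => l _; apply: mulr_ge0; apply: ge0.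
by rewrite addr0 -(natrD _ 1 1) (ler_nat _ 2 1).
Qed.

(** In a hook, only the first row and the first column can have more than one box; [A] stands for
    that row or column. *)
Lemma fiber_stab_Sym (f : 'I_N -> nat) A :
    (forall x y, (f x == f y) = (x == y) || (x \in A) && (y \in A)) ->
  fiber_stab_group f = perm.Sym_group A.
Proof.
move=> fA; apply/val_inj/setP=> s; rewrite /= !inE.
apply/forallP/idP => [fs | As x].
  apply/subsetP=> x; rewrite inE => sx; have := fs x.
  by rewrite fA (negPf sx) => /andP[].
rewrite fA (perm_closed _ As) andbb; case: (boolP (x \in A)); first by rewrite orbT.
by move/(out_perm As)->; rewrite eqxx.
Qed.

Section HookShape.
Variable j : nat.
Hypothesis jN : (j < N)%N.
Let la := (N - j)%N :: nseq j 1%N.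

Lemma hook_is_partition : is_partition N la.
Proof.
rewrite /is_partition /la /=; apply/andP; split; last by rewrite sumn_nseq; lia.
have : (1 <= N - j)%N by lia.
by elim: (j) (N - j)%N => //= i IHi m m1; rewrite m1 /= IHi.
Qed.

Lemma hook_reshape (x : 'I_N) :
  reshape_index la x = (if (x < N - j)%N then 0 else (x - (N - j)).+1)%N /\
  reshape_offset la x = (if (x < N - j)%N then x : nat else 0)%N.
Proof.
pose r := (if (x < N - j)%N then 0 else (x - (N - j)).+1)%N.
pose c := (if (x < N - j)%N then x : nat else 0)%N.
have lt_c : (c < nth 0 la r)%N.
  rewrite /c /r; case: ifP => //= xk; rewrite nth_nseq ifT //.
  by have := ltn_ord x; lia.
(* [r] and [c] are the row and column of box [x]; [reshape_index] and [reshape_offset] are read off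
   by inverting [flatten_index]. *)
have eq_x : (x : nat) = flatten_index la r c.
  rewrite /flatten_index /r /c; case: ifP => //= xk; rewrite take_nseq ?sumn_nseq; last first.
    by have := ltn_ord x; lia.
  by lia.
by rewrite -/r -/c eq_x flatten_indexKl // flatten_indexKr.
Qed.

Lemma row_stab_hook : row_stab N la = perm.Sym_group (first_ords N (N - j)).
Proof.
apply: fiber_stab_Sym => x y; have [-> _] := hook_reshape x.
have [-> _] := hook_reshape y; rewrite !inE -val_eqE /=.
by case: (ltnP x (N - j)); case: (ltnP y (N - j)); lia.
Qed.

Definition hook_column : {set 'I_N} := [set x : 'I_N | (x == 0 :> nat) || (N - j <= x)%N].

Lemma col_stab_hook : col_stab N la = perm.Sym_group hook_column.
Proof.
apply: fiber_stab_Sym => x y; have [_ ->] := hook_reshape x.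
have [_ ->] := hook_reshape y; rewrite !inE -val_eqE /=.
by case: (ltnP x (N - j)); case: (ltnP y (N - j)); lia.
Qed.

Lemma card_hook_column : #|hook_column| = j.+1.
Proof.
pose x0 : 'I_N := Ordinal (leq_ltn_trans (leq0n j) jN).
have -> : hook_column = x0 |: ~: first_ords N (N - j).
  by apply/setP=> x; rewrite !inE -leqNgt -val_eqE.
rewrite cardsU1 !inE /= -leqNgt -ltnNge subn_gt0 jN cardsCs setCK card_ord.
by rewrite card_first_ords ?leq_subr // subKn // ltnW.
Qed.

(** The complement of the first row has [j] boxes and the first column [j.+1], so h_j occurs in both
    induced characters through e_j and e_(j+1); uniqueness identifies it with the result of
    [pick]. *)
Lemma partition_char_hook s : partition_char N la s = hook_trace j s.
Proof.
rewrite /partition_char hook_is_partition row_stab_hook col_stab_hook /=.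
set A := first_ords N (N - j); set B := hook_column.
have cA : #|A| = (N - j)%N by rewrite card_first_ords ?leq_subr.
have [m hook_m] := hook_cfun_irr jN; rewrite -hook_cfunE 1?ltnW // hook_m.
have m_row : m \in irr_constt ('Ind[G, perm.Sym_group A] 1).
  apply: constt_ext_Ind_Sym1; rewrite (@eq_ext_cfun _ _ (first_ords N j)); last first.
    by rewrite cardsCs setCK card_ord cA card_first_ords ?subKn // ltnW.
  by rewrite irr_consttE cfdotC -hook_m cfdot_hook_ext_diag // conjC1 oner_eq0.
have m_col : m \in irr_constt ('Ind[G, perm.Sym_group B] ('Res (sign_char N))).
  apply: constt_ext_Ind_Sym_sign; rewrite (@eq_ext_cfun _ _ (first_ords N j.+1)); last first.
    by rewrite card_hook_column card_first_ords.
  by rewrite irr_consttE cfdotC -hook_m cfdot_hook_ext // eqxx conjC1 oner_eq0.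
case: pickP => [i /andP[i_row i_col] | /(_ m)]; last by rewrite m_row m_col.
rewrite (@common_constt_unique ('Ind[G, perm.Sym_group A] 1)
  ('Ind[G, perm.Sym_group B] ('Res (sign_char N))) i m) //.
- by rewrite cfInd_char ?cfun1_char.
- by rewrite cfInd_char // cfRes_char ?lin_charW ?sign_char_lin.
apply: cfdot_Ind_Sym; first by apply/subsetP=> x; rewrite !inE -leqNgt orbC => ->.
by rewrite cA card_hook_column addnS subnK // ltnW.
Qed.

End HookShape.

End HookConstituents.

(** * Removing a 2-cycle *)

Section PermExtension.
Variables (T U : finType) (f : U -> T).
Hypothesis f_inj : injective f.
Implicit Types (p q : {perm U}) (X : {set U}).

Definition ext_fun p x := if [pick y | f y == x] is Some y then f (p y) else x.

Lemma ext_funE p y : ext_fun p (f y) = f (p y).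
Proof.
rewrite /ext_fun; case: pickP => [z /eqP/f_inj-> // | /(_ y)]; by rewrite eqxx.
Qed.

Lemma ext_fun_out p x : x \notin codom f -> ext_fun p x = x.
Proof.
by move=> fx; rewrite /ext_fun; case: pickP => // y /eqP eq_x; rewrite -eq_x codom_f in fx.
Qed.

Lemma ext_fun_inj p : injective (ext_fun p).
Proof.
apply: (can_inj (g := ext_fun p^-1)) => x.
have [/codomP[y ->] | fx] := boolP (x \in codom f); first by rewrite !ext_funE permK.
by rewrite !ext_fun_out.
Qed.

Definition ext_perm p : {perm T} := perm (@ext_fun_inj p).

Lemma ext_permE p y : ext_perm p (f y) = f (p y).
Proof. by rewrite permE ext_funE. Qed.

Lemma ext_perm_out p x : x \notin codom f -> ext_perm p x = x.
Proof. by rewrite permE; apply: ext_fun_out. Qed.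

Lemma ext_permM p q : ext_perm (p * q)%g = (ext_perm p * ext_perm q)%g.
Proof.
apply/permP=> x; rewrite permM.
have [/codomP[y ->] | fx] := boolP (x \in codom f); first by rewrite !ext_permE permM.
by rewrite !ext_perm_out.
Qed.

Lemma ext_tperm y z : ext_perm (tperm y z) = tperm (f y) (f z).
Proof.
apply/permP=> x; have [/codomP[u ->] | fx] := boolP (x \in codom f).
  by rewrite ext_permE inj_tperm.
by rewrite ext_perm_out // tpermD //; apply: contraNneq fx => <-; rewrite codom_f.
Qed.

Lemma odd_ext_perm p : odd_perm (ext_perm p) = odd_perm p.
Proof.
case: (prod_tpermP p) => ts -> _; elim: ts => [|t ts IHts].
  rewrite !big_nil odd_perm1 (_ : ext_perm 1 = 1%g) ?odd_perm1 //.
  by apply: (mulgI (ext_perm 1)); rewrite -ext_permM !mulg1.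
by rewrite !big_cons ext_permM ext_tperm !odd_mul_tperm IHts (inj_eq f_inj).
Qed.

Lemma ext_perm_inj : injective ext_perm.
Proof.
by move=> p q eq_pq; apply/permP=> y; apply: f_inj; rewrite -!ext_permE eq_pq.
Qed.

Variables a b : T.
Hypothesis ab : a != b.
Hypothesis codom_ab : codom f =i [predC [:: a; b]].

Lemma embed_neqL y : f y != a.
Proof. by have := codom_ab (f y); rewrite codom_f !inE; case: eqP. Qed.

Lemma embed_neqR y : f y != b.
Proof. by have := codom_ab (f y); rewrite codom_f !inE orbC; case: eqP. Qed.

Variant swap_ext_spec : T -> Type :=
  | SwapExtL : swap_ext_spec a
  | SwapExtR : swap_ext_spec b
  | SwapExtIn y : swap_ext_spec (f y).

Lemma swap_extP x : swap_ext_spec x.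
Proof.
case: (eqVneq x a) => [-> | xa]; first exact: SwapExtL.
case: (eqVneq x b) => [-> | xb]; first exact: SwapExtR.
have fx : x \in codom f by rewrite codom_ab !inE negb_or xa.
by rewrite -(f_iinv fx); exact: SwapExtIn.
Qed.

Definition swap_ext p : {perm T} := (tperm a b * ext_perm p)%g.

Lemma swap_ext_a p : swap_ext p a = b.
Proof. by rewrite permM tpermL ext_perm_out // codom_ab !inE eqxx orbT. Qed.

Lemma swap_ext_b p : swap_ext p b = a.
Proof. by rewrite permM tpermR ext_perm_out // codom_ab !inE eqxx. Qed.

Lemma swap_extE p y : swap_ext p (f y) = f (p y).
Proof. by rewrite permM tpermD 1?eq_sym ?embed_neqL ?embed_neqR // ext_permE. Qed.

Lemma odd_swap_ext p : odd_perm (swap_ext p) = ~~ odd_perm p.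
Proof. by rewrite odd_mul_tperm ab odd_ext_perm. Qed.

(** [swap_ext] is injective, and a count gives surjectivity: multiplication by [tperm a b] sends the
    permutations swapping [a] and [b] to permutations supported off these points, of which there are
    as many as elements of [{perm U}]. *)
Lemma sum_swap_ext (R : nmodType) (F : {perm T} -> R) :
  \sum_(s : {perm T} | (s a == b) && (s b == a)) F s = \sum_p F (swap_ext p).
Proof.
have h_inj : injective swap_ext by move=> p q /mulgI/ext_perm_inj.
rewrite -(big_imset F (A := predT)) /=; last by move=> p q _ _; exact: h_inj.
apply: eq_bigl => s.
suff -> : swap_ext @: predT = [set s : {perm T} | (s a == b) && (s b == a)] by rewrite inE.
apply/eqP; rewrite eqEcard; apply/andP; split.
  by apply/subsetP=> _ /imsetP[p _ ->]; rewrite inE swap_ext_a swap_ext_b !eqxx.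
rewrite card_imset //.
rewrite [leqRHS](_ : _ = #|~: [set a; b]|`!); last first.
  transitivity #|perm_on [set: U]|.
    by apply: eq_card => p; rewrite !inE; apply/esym/subsetP=> x _; rewrite inE.
  rewrite card_perm cardsT -(card_codom f_inj); congr (_`!).
  by apply: eq_card => x; rewrite codom_ab !inE.
rewrite -card_perm -(card_imset _ (mulgI (tperm a b))).
apply: subset_leq_card; apply/subsetP=> _ /imsetP[u u_ab ->].
move: u_ab; rewrite inE => /andP[/eqP ua /eqP ub].
apply/subsetP=> x; rewrite !inE permM; case: tpermP => [-> | -> | /eqP xa /eqP xb _].
- by rewrite ub eqxx.
- by rewrite ua eqxx.
by rewrite negb_or xa xb.
Qed.

Lemma imset_codom_notin X : (a \notin f @: X) && (b \notin f @: X).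
Proof.
apply/andP; split; apply/imsetP=> [[y _ /esym/eqP]]; first exact/negP/embed_neqL.
exact/negP/embed_neqR.
Qed.

Lemma swap_ext_stab p X :
  (swap_ext p \in 'N(f @: X | 'P)%g) = (p \in 'N(X | 'P)%g).
Proof.
have /andP[aX bX] := imset_codom_notin X.
apply/astabsP/astabsP => [pX y | pX x] /=; rewrite !apermE.
  by have := pX (f y); rewrite /= apermE swap_extE !mem_imset.
case: (swap_extP x) => [||y]; rewrite ?swap_ext_a ?swap_ext_b ?(negPf aX) ?(negPf bX) //.
by rewrite swap_extE !mem_imset //; exact: pX.
Qed.

Lemma swap_ext_stabU p X :
  (swap_ext p \in 'N(a |: (b |: f @: X) | 'P)%g) = (p \in 'N(X | 'P)%g).
Proof.
apply/astabsP/astabsP => [pX y | pX x] /=; rewrite !apermE.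
  have := pX (f y); rewrite /= apermE swap_extE !inE.
  by rewrite !(negPf (embed_neqL _)) !(negPf (embed_neqR _)) !mem_imset.
case: (swap_extP x) => [||y]; rewrite ?swap_ext_a ?swap_ext_b ?inE ?eqxx ?orbT //.
rewrite swap_extE !(negPf (embed_neqL _)) !(negPf (embed_neqR _)) !mem_imset //; exact: pX.
Qed.

Lemma set_sign_swap_ext p X : p \in 'N(X | 'P)%g ->
  set_sign (f @: X) (swap_ext p) = set_sign X p.
Proof.
move=> pX; rewrite /set_sign -odd_ext_perm; congr (_ ^+ odd_perm _).
have /andP[aX bX] := imset_codom_notin X.
apply/permP=> x; rewrite restr_permEif ?swap_ext_stab //.
case: (swap_extP x) => [||y].
- by rewrite (negPf aX) ext_perm_out // codom_ab !inE eqxx.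
- by rewrite (negPf bX) ext_perm_out // codom_ab !inE eqxx orbT.
by rewrite ext_permE mem_imset // restr_permEif // swap_extE; case: ifP.
Qed.

(** The restriction is [swap_ext] of the restriction of [p]; the extra transposition gives the minus
    sign. *)
Lemma set_sign_swap_extU p X : p \in 'N(X | 'P)%g ->
  set_sign (a |: (b |: f @: X)) (swap_ext p) = - set_sign X p.
Proof.
move=> pX; rewrite /set_sign -signrN -odd_swap_ext.
congr (_ ^+ odd_perm _); apply/permP=> x.
rewrite restr_permEif ?swap_ext_stabU // !inE.
case: (swap_extP x) => [||y].
- by rewrite eqxx !swap_ext_a.
- by rewrite eqxx orbT !swap_ext_b.
rewrite (negPf (embed_neqL _)) (negPf (embed_neqR _)) !swap_extE mem_imset // restr_permEif //=.
by case: ifP.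
Qed.

Lemma ext_trace_swap i p : ext_trace i (swap_ext p) =
  ext_trace i p - (if i is l.+2 then ext_trace l p else 0).
Proof.
(* Splitting on [a] suffices, since a stable set contains [b] exactly when it contains [a]. *)
rewrite /ext_trace (bigID (fun S : {set T} => a \in S)) /= addrC; congr (_ + _).
  rewrite (reindex_onto (fun X : {set U} => f @: X) (fun S => f @^-1: S)) /=.
    apply: eq_big => [X | X /andP[/andP[/andP[_ pX]] _]].
      have /andP[aX _] := imset_codom_notin X.
      rewrite swap_ext_stab card_imset // aX andbT -[RHS]andbT; congr (_ && _).
      by apply/eqP/setP=> y; rewrite inE mem_imset.
    by rewrite set_sign_swap_ext // -swap_ext_stab.
  move=> S /andP[/andP[_ pS] aS]; apply/setP=> x.
  have bS : b \notin S by rewrite -(swap_ext_a p) perm_stab_mem.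
  have /andP[aX bX] := imset_codom_notin (f @^-1: S).
  case: (swap_extP x) => [||y]; rewrite ?(negPf aX) ?(negPf bX) ?(negPf aS) ?(negPf bS) //.
  by rewrite mem_imset // inE.
rewrite (reindex_onto (fun X : {set U} => a |: (b |: f @: X)) (fun S => f @^-1: S)) /=.
  have cX X : #|a |: (b |: f @: X)| = #|X|.+2.
    have /andP[aX bX] := imset_codom_notin X.
    by rewrite !cardsU1 !inE negb_or ab aX bX card_imset.
  have fX X : f @^-1: (a |: (b |: f @: X)) == X.
    by apply/eqP/setP=> y; rewrite !inE (negPf (embed_neqL _)) (negPf (embed_neqR _)) mem_imset.
  transitivity (\sum_(X : {set U} | (#|X|.+2 == i) && (p \in 'N(X | 'P)%g)) - set_sign X p).
    apply: eq_big => [X | X /andP[/andP[/andP[_ pX]] _]].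
      by rewrite cX swap_ext_stabU fX setU11 !andbT.
    by rewrite set_sign_swap_extU // -swap_ext_stabU.
  (* For [i < 2] no set of size [i] contains both points, and the sum is empty. *)
  rewrite sumrN; case: i => [|[|i]]; [rewrite big_pred0 ?oppr0 // | | exact: erefl].
  by rewrite big_pred0 ?oppr0.
move=> S /andP[/andP[_ pS] aS]; apply/setP=> x.
have bS : b \in S by rewrite -(swap_ext_a p) perm_stab_mem.
case: (swap_extP x) => [||y]; rewrite !inE ?eqxx ?orbT //.
by rewrite (negPf (embed_neqL _)) (negPf (embed_neqR _)) mem_imset // inE.
Qed.

Lemma hook_trace_swap j p : hook_trace j (swap_ext p) =
  hook_trace j p - (if j is i.+2 then hook_trace i p else 0).
Proof.
elim: j => [|[|j] IHj] /=; rewrite ext_trace_swap ?subr0 //.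
  by rewrite ext_trace_swap subr0.
rewrite -/(hook_trace j.+1 (swap_ext p)) IHj -/(hook_trace j.+1 p).
(* [y] is h_(j-1), or 0 when [j] is 0; it is also the term subtracted from e_j in h_j. *)
set y := (X in _ - (_ - X)); have -> : hook_trace j p = ext_trace j p - y.
  by rewrite /y; case: (j).
move: (ext_trace _ _) (ext_trace _ _) (hook_trace _ _) y => u v w y; ring.
Qed.

End PermExtension.

(** * Degenerate hooks and the removal of dominoes *)

Lemma ext_trace0 (T : finType) (s : {perm T}) : ext_trace 0 s = 1.
Proof.
rewrite /ext_trace (big_pred1 set0) => [|S].
  by rewrite /set_sign (perm_on_id (restr_perm_on _ _)) ?cards0 // odd_perm1.
have n0 : s \in 'N(set0 | 'P)%g by apply/astabsP=> x; rewrite !in_set0.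
by rewrite cards_eq0 /=; case: (eqVneq S set0) => [-> | //]; rewrite n0.
Qed.

Lemma ext_trace_large (T : finType) i (s : {perm T}) : (#|T| < i)%N ->
  ext_trace i s = 0.
Proof.
move=> ltTi; rewrite /ext_trace big_pred0 // => S; apply/negP=> /andP[/eqP cS _].
by have := max_card [in S]; rewrite cS leqNgt ltTi.
Qed.

Section SmallHooks.
Variable N : nat.
Implicit Types (s : 'S_N).

(** At [j = N] the class function has norm 0; beyond, both terms of the recursion vanish. *)
Lemma hook_trace_large j s : (0 < N)%N -> (N <= j)%N -> hook_trace j s = 0.
Proof.
move=> N0; elim: j => [|j IHj]; first by rewrite leqNgt N0.
rewrite leq_eqVlt => /orP[/eqP <- | ltNj]; first by rewrite -hook_cfunE // hook_cfunN // cfunE.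
by rewrite /= IHj // subr0 ext_trace_large // card_ord.
Qed.

Definition hook_char (a b : int) : 'CF([set: 'S_N]) :=
  if hook a b is Some la then partition_char N la else 0.

Lemma hook_charE (k j : nat) s : (0 < N)%N -> (k + j = N)%N ->
  hook_char k j s = hook_trace j s.
Proof.
move=> N0 kjN; rewrite /hook_char.
have -> : hook k j = Some (k :: nseq j 1%N) by case: k {kjN} => [|[|k]].
case: (posnP k) => [k0 | k0].
  (* A 0 followed by ones is not weakly decreasing, so the character is 0, as is [hook_trace N]. *)
  rewrite hook_trace_large //; last by lia.
  rewrite /partition_char (_ : is_partition _ _ = false) ?cfunE //.
  by rewrite /is_partition k0; case: j kjN => // kN; rewrite -kN k0 in N0.
have -> : k = (N - j)%N by lia.
by rewrite partition_char_hook //; lia.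
Qed.

End SmallHooks.

(** The group is trivial, so both induced characters are principal. Removing a vertical domino from
    (1,1) leaves [[::]], and a horizontal one from (2) leaves [[:: 0]]. *)
Lemma hook_char_empty (s : 'S_0) la : la = [::] \/ la = [:: 0%N] ->
  partition_char 0 la s = 1.
Proof.
move=> la0; have triv (H : {group 'S_0}) : H = [set: 'S_0]%G.
  apply/val_inj/setP=> g; rewrite inE (_ : g = 1%g) ?group1 //.
  by apply/permP=> -[].
have part_la : is_partition 0 la by case: la0 => ->.
rewrite /partition_char part_la (triv (row_stab 0 la)) (triv (col_stab 0 la)) /=.
rewrite !cfInd_id.
have -> : 'Res (sign_char 0) = 1 :> 'CF([set: 'S_0]%G).
  apply/cfunP=> g; rewrite cfRes_id sign_charE cfun1E inE (_ : g = 1%g) ?odd_perm1 //.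
  by apply/permP=> -[].
rewrite -irr0; case: pickP => [i /andP[] | /(_ 0)]; last by rewrite constt_irr !inE eqxx.
by rewrite constt_irr inE => /eqP-> _; rewrite irr0 cfun1E inE.
Qed.

Lemma hook_char_domino n N k (p : 'S_N) : (0 < k <= n)%N -> n = N.+2 ->
  hook_char N (k%:Z - 2) (n%:Z - k%:Z) p - hook_char N k%:Z (n%:Z - k%:Z - 2) p =
  hook_trace (n - k) p - (if (n - k)%N is i.+2 then hook_trace i p else 0).
Proof.
move=> /andP[k0 kn] nN; have [N0 | N0] := posnP N.
  subst N; have /orP[/eqP k1 | /eqP k2] : (k == 1)%N || (k == 2)%N by lia.
    rewrite k1 nN /hook_char /= hook_char_empty ?cfunE; last by left.
    by rewrite ext_trace_large ?card_ord // ext_trace0 !subr0.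
  rewrite k2 nN /hook_char /= hook_char_empty ?cfunE; last by right.
  by rewrite ext_trace0 !subr0.
have first : hook_char N (k%:Z - 2) (n%:Z - k%:Z) p = hook_trace (n - k) p.
  have [k2 | k1] := leqP 2 k.
    have -> : k%:Z - 2 = (k - 2)%N by lia.
    have -> : n%:Z - k%:Z = (n - k)%N by lia.
    by rewrite hook_charE //; lia.
  (* Here [k - 2] is negative and the immanant is 0 by convention; h_(n-1) also vanishes on
     [N = n - 2] points. *)
  have -> : k = 1%N by lia.
  rewrite hook_trace_large; [by rewrite /hook_char /= cfunE | by [] | by lia].
rewrite first; congr (_ - _).
case eq_j : (n - k)%N => [|[|i]].
- have -> : n%:Z - k%:Z - 2 = Negz 1 by lia.
  by rewrite /hook_char /=; case: k {k0 kn first eq_j} => [|[|k]]; rewrite cfunE.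
(* The exceptional value of [hook] at (1, -1) would need [k = 1], hence [n = 2] and [N = 0], which
   is already settled. *)
- have -> : n%:Z - k%:Z - 2 = Negz 0 by lia.
  rewrite /hook_char /=; case: k {first} k0 kn eq_j => [|[|k]] //= *; last by rewrite cfunE.
  by lia.
have -> : n%:Z - k%:Z - 2 = i by lia.
by rewrite hook_charE //; lia.
Qed.
(** * Immanants of graphs *)

Section GraphWeights.
Variable n : nat.
Implicit Types (G : sgraph n) (s : 'S_n) (i j a b : 'I_n).

Definition perm_weight G s : {poly algC} :=
  \prod_i char_poly_mx (adj_matrix G) i (s i).

Lemma hook_polyE (x y : int) G :
  hook_poly x y G = \sum_s hook_char n x y s *: perm_weight G s.
Proof.
rewrite /hook_poly /hook_immanant /hook_char; case: (hook x y) => [la //|].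
by rewrite big1 // => s _; rewrite cfunE scale0r.
Qed.

Lemma char_poly_adjE G i j :
  char_poly_mx (adj_matrix G) i j = if i == j then 'X else - (adj G i j)%:R.
Proof.
rewrite !mxE; case: eqP => [-> | _]; rewrite ?adj_irr ?subr0 //.
by rewrite mulr0n sub0r rmorph_nat.
Qed.

Definition fixed_points s := [set i | s i == i].

Lemma deriv_perm_weight G s :
  'X * (perm_weight G s)^`() = #|fixed_points s|%:R * perm_weight G s.
Proof.
have [c ->] : exists c : algC, perm_weight G s = c%:P * 'X^#|fixed_points s|.
  exists (\prod_(i | s i != i) - (adj G i (s i))%:R).
  rewrite /perm_weight (bigID (fun i => s i == i)) /= mulrC rmorph_prod; congr (_ * _).
    apply: eq_bigr => i si; rewrite char_poly_adjE eq_sym (negPf si).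
    by rewrite rmorphN rmorph_nat.
  rewrite -prodr_const; apply: eq_big => [i | i si]; first by rewrite inE.
  by rewrite char_poly_adjE eq_sym si.
rewrite derivM derivC mul0r add0r derivXn -[_ *+ _]mulr_natl.
case: #|_| => [|m]; first by rewrite !mul0r !mulr0.
by rewrite exprS; ring.
Qed.

Lemma perm_weight_del_edge G s a b : a != b ->
  perm_weight (del_edge G a b) s =
  if (s a == b) || (s b == a) then 0 else perm_weight G s.
Proof.
move=> ab; have gone i j : [set i; j] = [set a; b] -> i != j ->
    char_poly_mx (adj_matrix (del_edge G a b)) i j = 0.
  move=> eq_ij /negPf neq_ij; rewrite char_poly_adjE neq_ij /= /del_edge_rel eq_ij.
  by rewrite eqxx andbF oppr0.
rewrite /perm_weight; case: ifPn => [/orP[] /eqP sab | ].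
- by rewrite (bigD1 a) //= gone ?sab ?mul0r.
- by rewrite (bigD1 b) //= gone ?sab ?mul0r // 1?eq_sym // setUC.
rewrite negb_or => /andP[/eqP sa /eqP sb]; apply: eq_bigr => i _.
rewrite !char_poly_adjE; case: eqP => // i_si; congr (- (nat_of_bool _)%:R).
rewrite /= /del_edge_rel; case: eqP => [eq_i | _]; last by rewrite andbT.
have : i \in [set a; b] by rewrite -eq_i set21.
have : s i \in [set a; b] by rewrite -eq_i set22.
by rewrite !inE => /orP[] /eqP si /orP[] /eqP ei; subst i; congruence.
Qed.

(** A nonzero weight makes [i] and [s i] adjacent for every moved point [i], so moved points
    correspond to uses of edges, counted with direction. *)
Lemma sum_edge_uses G s : perm_weight G s != 0 ->
  (\sum_(e in edges G) ((s e.1 == e.2) + (s e.2 == e.1)) + #|fixed_points s| = n)%N.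
Proof.
move=> nz; have adjE i : adj G i (s i) = (s i != i).
  case: eqP => [-> | /eqP si]; first by rewrite adj_irr.
  apply: contraR nz => /negPf adj0; rewrite /perm_weight (bigD1 i) //=.
  by rewrite char_poly_adjE (eq_sym i) (negPf si) adj0 oppr0 mul0r.
pose uses i j : nat := adj G i j && (s i == j).
have usesE : (\sum_i \sum_j uses i j = #|~: fixed_points s|)%N.
  rewrite -sum1_card [RHS]big_mkcond /=; apply: eq_bigr => i _; rewrite !inE -adjE.
  rewrite (bigD1 (s i)) //= big1 ?addn0 => [|j /negPf]; first by rewrite /uses eqxx andbT.
  by rewrite /uses eq_sym => ->; rewrite andbF.
rewrite -[RHS]card_ord -[RHS](cardsC (fixed_points s)) addnC; congr (_ + _)%N.
rewrite -usesE pair_bigA [RHS](bigID (fun p : 'I_n * 'I_n => p.1 < p.2)%N) [LHS]big_split /=.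
congr (_ + _)%N.
  rewrite big_mkcond [RHS]big_mkcond; apply: eq_bigr => -[i j] _.
  by rewrite inE /uses /=; case: ltnP => //=; case: (adj G i j).
(* Exchanging coordinates folds the pairs with [p.1 > p.2] onto edges; the diagonal contributes
   nothing. *)
have swapK : involutive (fun p : 'I_n * 'I_n => (p.2, p.1)) by case.
rewrite [RHS](reindex_inj (can_inj swapK)) /= big_mkcond [RHS]big_mkcond.
apply: eq_bigr => -[i j] _; rewrite inE /uses /= adj_sym.
case: (ltngtP i j) => //= [_ | /val_inj->]; first by case: (adj G j i).
by rewrite adj_irr.
Qed.

(** For the truth values u and v of the two directed uses of an edge, 1 - u - v = (1 - (u or v)) -
    (u and v); summing over edges gives m - n plus the number of fixed points. *)
Lemma perm_weight_edges G s :
  (#|edges G|%:R - n%:R) * perm_weight G s + 'X * (perm_weight G s)^`() =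
  \sum_(e in edges G) (perm_weight (del_edge G e.1 e.2) s -
    (if (s e.1 == e.2) && (s e.2 == e.1) then perm_weight G s else 0)).
Proof.
rewrite deriv_perm_weight -mulrDl.
have edge_neq (e : 'I_n * 'I_n) : e \in edges G -> e.1 != e.2.
  by rewrite inE => /andP[lt_e _]; rewrite -val_eqE ltn_eqF.
have [w0 | nz] := eqVneq (perm_weight G s) 0.
  rewrite w0 mulr0 big1 // => e /edge_neq ne.
  by rewrite perm_weight_del_edge // w0 !if_same subr0.
have /(congr1 (fun m => m%:R : {poly algC})) := sum_edge_uses nz.
rewrite natrD => <-; rewrite opprD addrA subrK.
rewrite -sum1_card !natr_sum -sumrB mulr_suml; apply: eq_bigr => e /edge_neq ne.
rewrite perm_weight_del_edge //.
by case: (_ == _); case: (_ == _); rewrite /=; ring.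
Qed.

End GraphWeights.

(** * Permutations swapping the ends of an edge, and vertex deletion *)

Section VertexDeletion.
Variables (n : nat) (G : sgraph n) (a b : 'I_n).
Hypothesis ab : a != b.
Local Notation N := #|~: [set a; b]|.
Local Notation f := (enum_val : 'I_N -> 'I_n).

Lemma codom_del_vertices : codom f =i [predC [:: a; b]].
Proof.
move=> x; rewrite !inE; apply/codomP/idP => [[y ->] | xab].
  by have := enum_valP y; rewrite !inE.
have xA : x \in ~: [set a; b] by rewrite !inE.
by exists (enum_rank_in xA x); rewrite enum_rankK_in.
Qed.

Lemma card_del_vertices : n = N.+2.
Proof. by have := cardsC [set a; b]; rewrite card_ord cards2 ab. Qed.

(** The entries at (a, b) and (b, a) are both -1, so their product is 1. *)
Lemma perm_weight_swap_ext (p : 'S_N) : adj G a b ->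
  perm_weight G (swap_ext (@enum_val_inj _ (mem (~: [set a; b]))) a b p) =
  perm_weight (del_vertices G a b) p.
Proof.
move=> Gab; have codomE := codom_del_vertices.
rewrite /perm_weight (bigD1 a) //= (bigD1 b) 1?eq_sym //= mulrA.
rewrite (swap_ext_a _ codomE) (swap_ext_b _ codomE) !char_poly_adjE.
rewrite (negPf ab) eq_sym (negPf ab) Gab adj_sym Gab mulrNN mulr1 mul1r.
rewrite (eq_bigl [in ~: [set a; b]]) => [|i]; last by rewrite !inE negb_or.
rewrite big_enum_val; apply: eq_bigr => y _.
by rewrite (swap_extE _ codomE) !char_poly_adjE (inj_eq enum_val_inj).
Qed.

Lemma sum_hook_trace_swap k : (0 < k <= n)%N -> adj G a b ->
  \sum_(s : 'S_n) hook_trace (n - k) s *: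
    (if (s a == b) && (s b == a) then perm_weight G s else 0) =
  Phi_horiz k G a b - Phi_vert k G a b.
Proof.
move=> kn Gab; have codomE := codom_del_vertices.
rewrite (eq_bigr (fun s : 'S_n => if (s a == b) && (s b == a) then
  hook_trace (n - k) s *: perm_weight G s else 0)) => [|s _]; last first.
  by case: ifP; rewrite ?scaler0.
rewrite -big_mkcond /= (sum_swap_ext (@enum_val_inj _ _) codomE).
rewrite /Phi_horiz /Phi_vert !hook_polyE -sumrB; apply: eq_bigr => p _.
rewrite -scalerBl (hook_char_domino _ kn card_del_vertices) perm_weight_swap_ext //.
by rewrite hook_trace_swap.
Qed.

End VertexDeletion.

Theorem theorem2 (n k : nat) (G : sgraph n) (k_ge1 : (1 <= k)%N)
    (k_le_n : (k <= n)%N) :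
  (#|edges G|%:R - n%:R) * Phi k G + 'X * (Phi k G)^`() =
  \sum_(e in edges G)
    (Phi k (del_edge G e.1 e.2) - Phi_horiz k G e.1 e.2 + Phi_vert k G e.1 e.2).
Proof.
have kn : (0 < k <= n)%N by rewrite k_ge1.
have PhiE (H : sgraph n) : Phi k H = \sum_s hook_trace (n - k) s *: perm_weight H s.
  rewrite /Phi hook_polyE; apply: eq_bigr => s _; congr (_ *: _).
  have -> : n%:Z - k%:Z = (n - k)%N by lia.
  by rewrite hook_charE //; lia.
rewrite PhiE raddf_sum /= !mulr_sumr -big_split /=.
(* By linearity the identity is applied to each permutation separately, with its hook trace as
   coefficient. *)
under eq_bigr => s _ do rewrite derivZ -!scalerAr -scalerDr perm_weight_edges scaler_sumr.
rewrite exchange_big; apply: eq_bigr => e; rewrite inE => /andP[lt_e Ge].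
under eq_bigr => s _ do rewrite scalerBr.
rewrite sumrB -PhiE sum_hook_trace_swap //; last by rewrite -val_eqE ltn_eqF.
by rewrite opprB addrCA addrC.
Qed.
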